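(* Let $\rho: G\to \mathrm{Bilip}(\mathbf{R})$ be a uniform quasisimilarity action of a group $G$ on $\mathbf{R}$. Then there exists $\phi\in\mathrm{Bilip}(\mathbf{R})$ such that $\phi\circ\rho(g)\circ\phi^{-1}\in\mathrm{Aff}(\mathbf{R})$ for all $g\in G$. Moreover, the bilipschitz constant for $\phi$ depends only on the quasisimilarity constant for $\rho$; that is, for each $K\ge 1$ there is $L\ge 1$ such that, for every group $G$ and every action $\rho$ of $G$ on $\mathbf{R}$ by $K$-quasisimilarities, such a $\phi$ can be chosen to be $L$-bilipschitz.
   Context: $\mathbf{R}$ has its usual metric. For a metric space $X$, a homeomorphism $h$ of $X$ is $k$-bilipschitz ($k\ge1$) if $\frac1k d(x,y)\le d(h(x),h(y))\le k\,d(x,y)$ for all $x,y\in X$; $\mathrm{Bilip}(X)$ is the group of all bilipschitz homeomorphisms of $X$. $\mathrm{Aff}(\mathbf{R})$ is the group of maps $x\mapsto rx+s$ with $r,s\in\mathbf{R}$, $r\ne0$ (orientation reversing maps are allowed). A function $f:X\to X$ is a $K$-quasisimilarity if for each distinct triple $x,y,z\in X$, $$\frac1K\le\frac{d(f(z),f(x))/d(z,x)}{d(f(y),f(x))/d(y,x)}\le K.$$ An action of a group $G$ on $X$ is a uniform quasisimilarity action if there exists $K\ge1$ (a quasisimilarity constant for the action) such that every $g\in G$ acts as a $K$-quasisimilarity of $X$. *)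

(* Defs.v *)
From HB Require Import structures.
From mathcomp Require Import all_boot all_order all_algebra.
From mathcomp Require Import all_classical all_reals all_analysis.

Set Implicit Arguments.
Unset Strict Implicit.
Unset Printing Implicit Defensive.

Import Order.TTheory GRing.Theory Num.Theory.
Local Open Scope classical_set_scope.
Local Open Scope ring_scope.

Section Bilipschitz.
Context {R : realFieldType} {X : metricType R}.

Definition is_homeomorphism (h h' : X -> X) : Prop :=
  [/\ cancel h h', cancel h' h, continuous h & continuous h'].

Definition is_bilipschitz (k : R) (h : X -> X) : Prop :=
  forall x y : X, k^-1 * mdist x y <= mdist (h x) (h y) <= k * mdist x y.

(* If h x = h y for some x != y, the denominator below is 0 and, since
   MathComp division by 0 yields 0, the lower bound fails for every K > 0. *)
Definition is_quasisimilarity (K : R) (f : X -> X) : Prop :=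
  forall x y z : X, x <> y -> y <> z -> x <> z ->
    K^-1 <= (mdist (f z) (f x) / mdist z x) / (mdist (f y) (f x) / mdist y x)
         <= K.

End Bilipschitz.

(* The inverse is stored as data; it is determined by the underlying map,
   see bilip_eq. *)
Record bilip (R : realFieldType) (X : metricType R) : Type := MkBilip {
  bilip_fun :> X -> X ;
  bilip_inv : X -> X ;
  bilip_homeo : is_homeomorphism bilip_fun bilip_inv ;
  bilip_bound : exists2 k : R, 1 <= k & is_bilipschitz k bilip_fun }.

Section BilipGroup.
Context {R : realFieldType} {X : metricType R}.
Implicit Types f g h : bilip X.

Lemma bilip_eq f g : (bilip_fun f = bilip_fun g) -> f = g.
Proof.
case: f g => [f f' hf bf] [g g' hg bg] /= efg; subst g.
have eg : f' = g'.
  apply/funext => x; case: hf hg => fK _ _ _ [_ gK _ _].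
  by rewrite -{1}(gK x) fK.
by subst g'; congr MkBilip; exact: Prop_irrelevance.
Qed.

Lemma bilip_one_homeo : is_homeomorphism (@id X) (@id X).
Proof. by split => // x; exact: cvg_id. Qed.

Lemma bilip_one_bound : exists2 k : R, 1 <= k & is_bilipschitz k (@id X).
Proof. by exists 1 => // x y; rewrite invr1 mul1r lexx. Qed.

Definition bilip_one : bilip X := MkBilip bilip_one_homeo bilip_one_bound.

Lemma bilip_mul_homeo f g :
  is_homeomorphism (f \o g) (bilip_inv g \o bilip_inv f).
Proof.
case: f g => [f f' [fK f'K cf cf'] _] [g g' [gK g'K cg cg'] _] /=.
split; [exact: can_comp|exact: can_comp| |].
- by move=> x; apply: continuous_comp; [exact: cg|exact: cf].
- by move=> x; apply: continuous_comp; [exact: cf'|exact: cg'].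
Qed.

Lemma bilip_mul_bound f g :
  exists2 k : R, 1 <= k & is_bilipschitz k (f \o g).
Proof.
case: f g => [f f' _ [k k1 fk]] [g g' _ [l l1 gl]] /=.
have k0 : 0 < k by exact: lt_le_trans k1.
have l0 : 0 < l by exact: lt_le_trans l1.
exists (k * l); first by rewrite -[1]mulr1 ler_pM.
move=> x y /=; have /andP[f1 f2] := fk (g x) (g y).
have /andP[g1 g2] := gl x y; apply/andP; split.
  by rewrite invfM -mulrA (le_trans _ f1)// ler_pM2l ?invr_gt0.
by rewrite (le_trans f2)// -mulrA ler_pM2l.
Qed.

Definition bilip_mul f g : bilip X :=
  MkBilip (bilip_mul_homeo f g) (bilip_mul_bound f g).

Lemma bilip_inv_homeo f : is_homeomorphism (bilip_inv f) f.
Proof. by case: f => f f' []. Qed.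

Lemma bilip_inv_bound f : exists2 k : R, 1 <= k & is_bilipschitz k (bilip_inv f).
Proof.
case: f => f f' [fK f'K _ _] [k k1 fk] /=.
have k0 : 0 < k by exact: lt_le_trans k1.
exists k => // x y; have := fk (f' x) (f' y); rewrite !f'K => /andP[f1 f2].
by rewrite ler_pdivrMl// f2/= -ler_pdivrMl.
Qed.

Definition bilip_invg f : bilip X :=
  MkBilip (bilip_inv_homeo f) (bilip_inv_bound f).

Lemma bilip_mulA : associative bilip_mul.
Proof. by move=> f g h; exact: bilip_eq. Qed.

Lemma bilip_mul1 : left_id bilip_one bilip_mul.
Proof. by move=> f; exact: bilip_eq. Qed.

Lemma bilip_mulr1 : right_id bilip_one bilip_mul.
Proof. by move=> f; exact: bilip_eq. Qed.

Lemma bilip_mulV : left_inverse bilip_one bilip_invg bilip_mul.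
Proof.
by move=> f; apply: bilip_eq; case: f => f f' [fK ? ? ?] ?; exact/funext.
Qed.

Lemma bilip_mulrV : right_inverse bilip_one bilip_invg bilip_mul.
Proof.
by move=> f; apply: bilip_eq; case: f => f f' [? fK ? ?] ?; exact/funext.
Qed.

HB.instance Definition _ := gen_eqMixin (bilip X).
HB.instance Definition _ := gen_choiceMixin (bilip X).
HB.instance Definition _ := isGroup.Build (bilip X)
  bilip_mulA bilip_mul1 bilip_mulr1 bilip_mulV bilip_mulrV.

End BilipGroup.

Definition quasisimilarity_action (R : realFieldType) (G : groupType)
    (X : metricType R) (K : R) (rho : G -> bilip X) : Prop :=
  forall g : G, is_quasisimilarity K (rho g).

Definition uniform_quasisimilarity_action (R : realFieldType) (G : groupType)
    (X : metricType R) (rho : G -> bilip X) : Prop :=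
  exists2 K : R, 1 <= K & quasisimilarity_action K rho.

Definition Aff (R : realType) : set (R^o -> R^o) :=
  [set f | exists r s : R, r != 0 /\ forall x : R, f x = r * x + s].
Arguments Aff R : clear implicits.

(* Main.v *)
Require Import Defs.
From mathcomp Require Import all_boot all_order all_algebra.
From mathcomp Require Import all_classical all_reals all_analysis.
From mathcomp Require Import ring lra.

(** A K-quasisimilarity [g] of the line has a well-defined size up to a bounded
    factor: all its difference quotients agree with the single number
    [stretch g], the distance between the images of 0 and 1, up to the factor
    C = K ^ 2 ([quasisimilarity_dist_le]).  Hence [stretch] is multiplicative
    up to the factor C, and its logarithm is a quasimorphism of defect at most
    [ln C].

    The main point is that this quasimorphism is at bounded distance from a
    genuine homomorphism ([stretch_character]).  For orientation preserving
    elements, compare [f] and [h] by their values near +oo: [f] is below [h]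
    when [f x <= h x] for all large [x].  This is a preorder, invariant under
    multiplication on both sides, and [stretch] is monotone for it up to a
    factor.  It is total: if neither [f] nor [h] is eventually above the other,
    then by continuity their graphs meet arbitrarily far out, so that
    [h^-1 * f] has two fixed points; its powers then have bounded stretch, and
    a point that it moved would drift away linearly although its distance to
    the fixed point stays bounded, so that [h^-1 * f] is the identity
    ([increasing_two_fixpoints]).  As in Hoelder's theorem on ordered groups,
    one of [f * h] and [h * f] is below the other, which encloses
    [(f * h) ^+ n] between [f ^+ n * h ^+ n] and [h ^+ n * f ^+ n]; the error in
    the additivity of the homogenized quasimorphism at the n-th powers is
    therefore bounded in n, hence zero.  The orientation preserving elements
    form a subgroup of index at most two, and additivity passes from it to the
    whole group ([homogenization_additive_of_index2]).

    Let c be the resulting character of the group.  The functions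
    |g x - g y| / c g are all comparable to |x - y|, and the element [h]
    permutes them up to the factor c h.  The least additive length that
    dominates all of them, [least_length], is therefore multiplied by c h
    under [h], and lies between |x - y| and C ^ 2 |x - y|.  Integrating this
    length from 0 gives the coordinate [phi], which is C ^ 2-bilipschitz, that
    is K ^ 4-bilipschitz, and in which every [h] multiplies differences by a
    constant, that is, becomes affine. *)

Set Implicit Arguments.
Unset Strict Implicit.
Unset Printing Implicit Defensive.

Import Order.TTheory GRing.Theory Num.Theory.
Import numFieldNormedType.Exports.
Local Open Scope classical_set_scope.
Local Open Scope ring_scope.

(** * Quasimorphisms and their homogenizations *)

Lemma le0_of_bounded_multiples (R : realType) (x M : R) :
  (forall n : nat, n%:R * x <= M) -> x <= 0.
Proof.
move=> xM; rewrite leNgt; apply/negP => x0.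
have M0 : 0 <= M by have := xM 0%N; rewrite mul0r.
have := archi_boundP (divr_ge0 M0 (ltW x0)).
by rewrite ltr_pdivrMr// ltNge xM.
Qed.

Lemma eq_of_bounded_multiples (R : realType) (x y M : R) :
  (forall n : nat, `|n%:R * x - n%:R * y| <= M) -> x = y.
Proof.
move=> xyM; apply/eqP; rewrite -subr_eq0 eq_le -oppr_le0.
by apply/andP; split; apply: (@le0_of_bounded_multiples _ _ M) => n;
  have := xyM n; rewrite ler_norml => /andP[]; lra.
Qed.

(** Adding [D] makes [u] subadditive and subtracting [D] makes it superadditive,
    so the upper quotients [(u n + D) / n] all lie above the lower ones
    [(u n - D) / n], and any number separating them is the slope. *)
Lemma quasiadditive_sequence_slope (R : realType) (u : nat -> R) (D : R) :
  (forall m n, `|u (m + n)%N - u m - u n| <= D) ->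
  exists q : R, forall n, `|u n - n%:R * q| <= D.
Proof.
move=> uD.
have uB m n : u m + u n - D <= u (m + n)%N <= u m + u n + D.
  by have := uD m n; rewrite ler_norml => /andP[? ?]; apply/andP; split; lra.
have ub m k : u (m * k.+1)%N + D <= k.+1%:R * (u m + D).
  elim: k => [|k IH]; first by rewrite muln1 mul1r.
  have /andP[_] := uB m (m * k.+1)%N; rewrite -mulnS => ?.
  by rewrite [k.+2%:R]mulrS mulrDl mul1r; lra.
have us n k : n.+1%:R * (u k - D) <= u (k * n.+1)%N - D.
  elim: n => [|n IH]; first by rewrite muln1 mul1r.
  have /andP[+ _] := uB k (k * n.+1)%N; rewrite -mulnS => ?.
  by rewrite [n.+2%:R]mulrS mulrDl mul1r; lra.
pose E := [set (u n.+1 + D) / n.+1%:R | n in setT].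
have lowE n : lbound E ((u n.+1 - D) / n.+1%:R).
  move=> _ [m _ <-]; rewrite ler_pdivrMr ?ltr0n// mulrAC ler_pdivlMr ?ltr0n//.
  have D0 : 0 <= D := le_trans (normr_ge0 _) (uD 0%N 0%N).
  by have := us m n.+1; have := ub m.+1 n; rewrite mulnC; lra.
have E0 : E !=set0 by exists ((u 1%N + D) / 1); exists 0%N.
have hE : has_lbound E by eexists; exact: lowE 0%N.
exists (inf E) => -[|n].
  by have := uD 0%N 0%N; rewrite mul0r subr0 addn0 subrr sub0r normrN.
have h1 : inf E <= (u n.+1 + D) / n.+1%:R by apply: ge_inf => //; exists n.
have h2 : (u n.+1 - D) / n.+1%:R <= inf E by apply: lb_le_inf => //; exact: lowE.
move: h1 h2; rewrite ler_pdivlMr ?ltr0n// ler_pdivrMr ?ltr0n// => h1 h2.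
by rewrite ler_norml; apply/andP; split; lra.
Qed.

Section Quasimorphism.
Context {R : realType} {G : groupType}.

Lemma quasimorphism_homogenization (a : G -> R) (D : R) :
  (forall g h, `|a (g * h)%g - a g - a h| <= D) ->
  exists q : G -> R, forall g n, `|a (g ^+ n)%g - n%:R * q g| <= D.
Proof.
move=> aD.
have qP g : exists q : R, forall n, `|a (g ^+ n)%g - n%:R * q| <= D.
  apply: (@quasiadditive_sequence_slope R (fun n => a (g ^+ n)%g)) => m n.
  by rewrite expgnDr.
by have [q ?] := choice qP; exists q.
Qed.

Context (a q : G -> R) (D : R).
Hypothesis aD : forall g h, `|a (g * h)%g - a g - a h| <= D.
Hypothesis qD : forall g n, `|a (g ^+ n)%g - n%:R * q g| <= D.

Lemma homogenization_expgn g k : q (g ^+ k)%g = k%:R * q g.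
Proof.
apply: (@eq_of_bounded_multiples _ _ _ (D + D)) => n.
have := qD (g ^+ k)%g n; have := qD g (k * n)%N.
rewrite expgnA natrM !ler_norml => /andP[? ?] /andP[? ?].
by apply/andP; split; lra.
Qed.

(** The two products are conjugate, and the powers of conjugate elements differ
    by two fixed factors. *)
Lemma homogenization_mulC g h : q (g * h)%g = q (h * g)%g.
Proof.
have -> : (h * g)%g = ((g * h) ^ g)%g by rewrite conjgE -!mulgA mulKg.
apply: (@eq_of_bounded_multiples _ _ _ (4%:R * D + `|a g| + `|a g^-1%g|)) => n.
have := qD (g * h)%g n; have := qD ((g * h) ^ g)%g n; rewrite -conjXg conjgE.
have := aD g^-1%g ((g * h) ^+ n * g)%g; have := aD ((g * h) ^+ n)%g g.
have := lexx `|a g|; have := lexx `|a g^-1%g|; rewrite !ler_norml.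
by do 6!move=> /andP[? ?]; apply/andP; split; lra.
Qed.

Lemma homogenization_inv g : q g^-1%g = - q g.
Proof.
apply: (@eq_of_bounded_multiples _ _ _ (3%:R * D + `|a 1%g|)) => n.
have := qD g n; have := qD g^-1%g n; have := aD (g ^+ n)%g (g^-1 ^+ n)%g.
rewrite expVgn mulgV; have := lexx `|a 1%g|; rewrite !ler_norml.
by do 4!move=> /andP[? ?]; apply/andP; split; lra.
Qed.

(** Both [a (f ^+ n * h ^+ n)] and [a (h ^+ n * f ^+ n)] are within a bounded
    distance of [n * (q f + q h)]; dividing by [n] removes the errors. *)
Lemma homogenization_additive_of_squeeze (f h : G) (E : R) :
  (forall n, a (f ^+ n * h ^+ n)%g <= a ((f * h) ^+ n)%g + E) ->
  (forall n, a ((f * h) ^+ n)%g <= a (h ^+ n * f ^+ n)%g + E) ->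
  q (f * h)%g = q f + q h.
Proof.
move=> lo up; apply: (@eq_of_bounded_multiples _ _ _ (4%:R * D + E)) => n.
have := qD (f * h)%g n; have := qD f n; have := qD h n.
have := aD (f ^+ n)%g (h ^+ n)%g; have := aD (h ^+ n)%g (f ^+ n)%g.
have := lo n; have := up n; rewrite !ler_norml => ? ?.
by do 5!move=> /andP[? ?]; apply/andP; split; lra.
Qed.

(** The argument by which an Archimedean ordered group is shown to be
    commutative: if [f * h] is below [h * f], then moving each [f] past each [h]
    goes in one direction only, whence
    [f ^+ n * h ^+ n <= (f * h) ^+ n <= h ^+ n * f ^+ n]. *)
Lemma homogenization_additive_of_preorder (P : pred G) (le : G -> G -> Prop)
    (E : R) :
  P 1%g -> (forall f h, P f -> P h -> P (f * h)%g) ->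
  (forall f, le f f) -> (forall f g h, le f g -> le g h -> le f h) ->
  (forall f h, P f -> P h -> le f h \/ le h f) ->
  (forall f g h, P f -> P g -> P h -> le f g -> le (h * f)%g (h * g)%g) ->
  (forall f g h, P f -> P g -> P h -> le f g -> le (f * h)%g (g * h)%g) ->
  (forall f h, P f -> P h -> le f h -> a f <= a h + E) ->
  forall f h, P f -> P h -> q (f * h)%g = q f + q h.
Proof.
move=> P1 PM le_refl le_tr le_total leMl leMr a_le.
have PX f n : P f -> P (f ^+ n)%g.
  by move=> Pf; elim: n => [|n IH]; rewrite ?expg0// expgS; exact: PM.
suff additive_of_le f h : P f -> P h -> le (f * h)%g (h * f)%g ->
    q (f * h)%g = q f + q h.
  move=> f h Pf Ph; have [fh|hf] := le_total _ _ (PM _ _ Pf Ph) (PM _ _ Ph Pf).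
    exact: additive_of_le.
  by rewrite homogenization_mulC additive_of_le// addrC.
move=> Pf Ph fh.
have fhX n : le (f * h ^+ n)%g (h ^+ n * f)%g.
  elim: n => [|n IH]; first by rewrite expg0 mulg1 mul1g.
  rewrite expgS mulgA; apply: (le_tr _ (h * f * h ^+ n)%g).
    by apply: leMr; rewrite ?PM ?PX.
  by rewrite -!mulgA; apply: leMl; rewrite ?PM ?PX.
have fXh n : le (f ^+ n * h)%g (h * f ^+ n)%g.
  elim: n => [|n IH]; first by rewrite expg0 mulg1 mul1g.
  rewrite expgSr -mulgA; apply: (le_tr _ (f ^+ n * (h * f))%g).
    by apply: leMl; rewrite ?PM ?PX.
  by rewrite !mulgA; apply: leMr; rewrite ?PM ?PX.
apply: (@homogenization_additive_of_squeeze _ _ E) => n; apply: a_le;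
  rewrite ?PM ?PX ?PM//; elim: n => [|n IH]; rewrite ?expg0 ?mulg1//.
- rewrite expgSr [(h ^+ n.+1)%g]expgSr [((f * h) ^+ _)%g]expgSr.
  apply: (le_tr _ (f ^+ n * h ^+ n * (f * h))%g).
    rewrite -!mulgA; apply: leMl; rewrite ?PM ?PX//.
    by rewrite !mulgA; apply: leMr; rewrite ?PM ?PX.
  by apply: leMr; rewrite ?PM ?PX ?PM.
- rewrite [((f * h) ^+ _)%g]expgSr.
  apply: (le_tr _ (h ^+ n * f ^+ n * (f * h))%g).
    by apply: leMr; rewrite ?PM ?PX ?PM.
  rewrite [(h ^+ n.+1)%g]expgSr.
  have -> : (h ^+ n * f ^+ n * (f * h) = h ^+ n * (f ^+ n.+1 * h))%g.
    by rewrite expgSr !mulgA.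
  by rewrite -[(_ * h * _)%g]mulgA; apply: leMl; rewrite ?PM ?PX.
Qed.

(** The boolean [P] tells whether an element lies in a subgroup of index at
    most two.  If [g] lies in it and [h] does not, then
    [(g * h) ^+ 2 = g * (h * g * h^-1) * h ^+ 2] is a product of three elements
    of the subgroup, and [q] doubles on squares. *)
Lemma homogenization_additive_of_index2 (P : G -> bool) :
  (forall g h, P (g * h)%g = (P g == P h)) ->
  (forall g h, P g -> P h -> q (g * h)%g = q g + q h) ->
  forall g h, q (g * h)%g = q g + q h.
Proof.
move=> PM qM.
have P1 : P 1%g by have := PM 1%g 1%g; rewrite mulg1 eqxx.
have PV g : P g^-1%g = P g.
  by have := PM g g^-1%g; rewrite mulgV P1; case: (P g); case: (P g^-1%g).
have qM_pn g h : P g -> ~~ P h -> q (g * h)%g = q g + q h.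
  move=> Pg Ph; apply: (@mulfI _ 2%:R); first by rewrite pnatr_eq0.
  rewrite -homogenization_expgn.
  have -> : ((g * h) ^+ 2 = g * ((g ^ h^-1) * h ^+ 2))%g.
    by rewrite conjgE invgK !expg2 !mulgA mulgVK.
  have PJ : P (g ^ h^-1)%g by rewrite conjgE invgK !PM PV Pg (negbTE Ph).
  have P2 : P (h ^+ 2)%g by rewrite expg2 PM eqxx.
  rewrite qM//; last by rewrite PM PJ P2.
  rewrite qM// homogenization_expgn conjgE invgK homogenization_mulC mulgVK.
  ring.
have qM_np g h : ~~ P g -> P h -> q (g * h)%g = q g + q h.
  by move=> Pg Ph; rewrite homogenization_mulC qM_pn// addrC.
move=> g h; have [Pg|Pg] := boolP (P g); have [Ph|Ph] := boolP (P h).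
- exact: qM.
- exact: qM_pn.
- exact: qM_np.
- have := qM_np g^-1%g (g * h)%g; rewrite mulKg PV PM Pg.
  rewrite (negbTE Pg) (negbTE Ph) homogenization_inv => /(_ isT isT); lra.
Qed.

End Quasimorphism.

(** * Stretch factors and germs at infinity *)

Definition stretch (R : realType) (G : groupType) (F : G -> R -> R) (g : G) : R :=
  `|F g 1 - F g 0|.

(** An action on the line whose elements are similarities up to the uniform
    factor [C]; the scale of [g] is read off from the unit interval. *)
Record uniformly_scaling_action (R : realType) (G : groupType)
    (F : G -> R -> R) (C : R) : Prop := UniformlyScalingAction {
  scaling_act1 : forall x, F 1%g x = x ;
  scaling_actM : forall g h x, F (g * h)%g x = F g (F h x) ;
  scaling_continuous : forall g, continuous (F g) ;
  scaling_ge1 : 1 <= C ;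
  scaling_ub : forall g x y, `|F g x - F g y| <= C * stretch F g * `|x - y| ;
  scaling_lb : forall g x y, stretch F g * `|x - y| <= C * `|F g x - F g y| }.

(** The orientation character: elements act monotonically, so testing on the
    unit interval suffices. *)
Definition increasing_on_unit (R : realType) (G : groupType) (F : G -> R -> R)
  (g : G) : bool := F g 0 < F g 1.

Section Dynamics.
Context {R : realType} {G : groupType} {F : G -> R -> R} {C : R}.
Hypothesis FA : uniformly_scaling_action F C.

Let F1 := scaling_act1 FA.
Let FM := scaling_actM FA.
Let C1 := scaling_ge1 FA.
Let Fub := scaling_ub FA.
Let Flb := scaling_lb FA.
Local Notation lam := (stretch F).
Local Notation inc := (increasing_on_unit F).

Let C0 : 0 < C. Proof. exact: lt_le_trans C1. Qed.

Lemma scaling_actK g : cancel (F g) (F g^-1%g).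
Proof. by move=> x; rewrite -FM mulVg F1. Qed.

Lemma stretch_gt0 g : 0 < lam g.
Proof.
rewrite normr_gt0 subr_eq0; apply/eqP => /(can_inj (scaling_actK g))/eqP.
by rewrite oner_eq0.
Qed.

Lemma stretchM_le g h : lam (g * h)%g <= C * (lam g * lam h).
Proof. by rewrite {1}/stretch !FM mulrA; exact: Fub. Qed.

Lemma stretchM_ge g h : lam g * lam h <= C * lam (g * h)%g.
Proof. by rewrite {3}/stretch !FM; exact: Flb. Qed.

Lemma ln_stretch_quasimorphism g h :
  `|ln (lam (g * h)%g) - ln (lam g) - ln (lam h)| <= ln C.
Proof.
have [[g0 h0] gh0] := (stretch_gt0 g, stretch_gt0 h, stretch_gt0 (g * h)%g).
have le (x y : R) : 0 < x -> 0 < y -> x <= y -> ln x <= ln y.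
  by move=> x0 y0; rewrite ler_ln ?posrE.
have := le _ _ gh0 (mulr_gt0 C0 (mulr_gt0 g0 h0)) (stretchM_le g h).
have := le _ _ (mulr_gt0 g0 h0) (mulr_gt0 C0 gh0) (stretchM_ge g h).
rewrite !lnM ?posrE ?mulr_gt0// ler_norml => ? ?.
by apply/andP; split; lra.
Qed.

Lemma scaling_act_monotone g :
  {homo F g : x y / x < y} \/ {homo F g : x y /~ x < y}.
Proof.
have cF : {within [set` `]-oo, +oo[], continuous (F g)}.
  by apply: continuous_subspaceT => x; exact: scaling_continuous FA g x.
have iF : {in `]-oo, +oo[ &, injective (F g)}.
  by move=> x y _ _; exact: (can_inj (scaling_actK g)).
by have [h|h] := itv_continuous_inj_mono cF iF; [left|right] => x y;
  apply: h; rewrite in_itv.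
Qed.

Lemma scaling_act_increasing g : inc g -> {homo F g : x y / x < y}.
Proof.
rewrite /increasing_on_unit => gi.
have [//|/(_ 1 0 ltr01)] := scaling_act_monotone g.
by move=> /(lt_trans gi); rewrite ltxx.
Qed.

Lemma scaling_act_decreasing g : ~~ inc g -> {homo F g : x y /~ x < y}.
Proof.
by move=> gi; have [/(_ 0 1 ltr01) h|//] := scaling_act_monotone g; case/negP: gi.
Qed.

Lemma increasing_on_unitM g h : inc (g * h)%g = (inc g == inc h).
Proof.
rewrite /increasing_on_unit !FM -/(inc g) -/(inc h).
have [hg|hg] := boolP (inc g); have [hh|hh] := boolP (inc h).
- by rewrite eqxx scaling_act_increasing.
- rewrite /= ltNge ltW// scaling_act_increasing// .
  exact: scaling_act_decreasing.
- by rewrite ltNge ltW//= scaling_act_decreasing.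
- rewrite eqxx scaling_act_decreasing//.
  exact: scaling_act_decreasing.
Qed.

Lemma increasing_on_unit1 : inc 1%g.
Proof. by rewrite /increasing_on_unit !F1. Qed.

Lemma increasing_on_unitV g : inc g^-1%g = inc g.
Proof.
have := increasing_on_unitM g g^-1%g; rewrite mulgV increasing_on_unit1.
by case: (inc g); case: (inc _).
Qed.

Lemma scaling_act_expgn_fix g p n : F g p = p -> F (g ^+ n)%g p = p.
Proof.
by move=> gp; elim: n => [|n IH]; rewrite ?expg0 ?F1// expgS FM IH gp.
Qed.

(** The powers of [g] preserve the interval from [p] to [r], so their stretch is
    between [C^-1] and [C].  If [g] moved [x] to the right, each further step
    would be at least a fixed fraction of the first one, and the n-th iterate
    would drift away linearly in n; but it stays within a bounded distance of
    [p]. *)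
Lemma increasing_two_fixpoints_le g p r : inc g -> p < r ->
  F g p = p -> F g r = r -> forall x, F g x <= x.
Proof.
move=> gi pr gp gr x; rewrite leNgt; apply/negP => xgx.
have lam1 n : lam (g ^+ n)%g <= C /\ 1 <= C * lam (g ^+ n)%g.
  have rp0 : 0 < `|r - p| by rewrite normr_gt0 subr_eq0 gt_eqF.
  have := Fub (g ^+ n)%g r p; have := Flb (g ^+ n)%g r p.
  rewrite !scaling_act_expgn_fix// ler_pM2r// => ->; split => //.
  by rewrite -(ler_pM2r rp0) mul1r.
have step n : (F g x - x) <= C * C * (F (g ^+ n.+1)%g x - F (g ^+ n)%g x).
  have gni : {homo F (g ^+ n)%g : x y / x < y}.
    apply: scaling_act_increasing; elim: n => [|n IH].
      exact: increasing_on_unit1.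
    by rewrite expgS increasing_on_unitM gi IH.
  have := Flb (g ^+ n)%g (F g x) x; rewrite -FM -expgSr.
  rewrite !gtr0_norm ?subr_gt0//; last by rewrite expgSr FM gni.
  have [_ l1] := lam1 n; rewrite -(ler_pM2l C0) !mulrA; apply: le_trans.
  by rewrite ler_peMl// subr_ge0 ltW.
have drift n : n%:R * (F g x - x) <= C * C * (F (g ^+ n)%g x - x).
  elim: n => [|n IH]; first by rewrite expg0 F1 subrr mul0r mulr0.
  rewrite mulrS mulrDl mul1r; have := step n; move: IH.
  by rewrite !(mulrBr (C * C)); lra.
(* the drift is bounded, the iterates of [x] being trapped around [p] *)
suff : F g x - x <= 0 by rewrite subr_le0 leNgt xgx.
apply: (@le0_of_bounded_multiples _ _
  (C * C * (C * C * `|x - p| + `|x - p|))) => n.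
apply: le_trans (drift n) _; rewrite ler_pM2l ?mulr_gt0//.
have := Fub (g ^+ n)%g x p; rewrite (scaling_act_expgn_fix n gp) => h.
have [l1 _] := lam1 n.
have : C * lam (g ^+ n)%g * `|x - p| <= C * C * `|x - p|.
  by rewrite ler_wpM2r// ler_pM2l.
have := ler_norm (F (g ^+ n)%g x - p); have := ler_norm (p - x).
by rewrite (distrC p x); lra.
Qed.

Lemma increasing_two_fixpoints g p r : inc g -> p < r ->
  F g p = p -> F g r = r -> forall x, F g x = x.
Proof.
move=> gi pr gp gr x; apply/eqP; rewrite eq_le.
rewrite (@increasing_two_fixpoints_le g p r)//=.
have gV y : F g y = y -> F g^-1%g y = y.
  by move=> gy; rewrite -{1}gy scaling_actK.
have gVi : inc g^-1%g by rewrite increasing_on_unitV.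
have := @increasing_two_fixpoints_le g^-1%g p r gVi pr (gV _ gp) (gV _ gr) (F g x).
by rewrite scaling_actK.
Qed.

(** The order of germs at +oo. *)
Definition germ_le (f h : G) : Prop := exists M, forall x, M <= x -> F f x <= F h x.

Lemma germ_le_refl f : germ_le f f.
Proof. by exists 0. Qed.

Lemma germ_le_trans f g h : germ_le f g -> germ_le g h -> germ_le f h.
Proof.
move=> [M fg] [N gh]; exists (Num.max M N) => x; rewrite ge_max => /andP[? ?].
by rewrite (le_trans (fg x _) (gh x _)).
Qed.

Lemma germ_leMl f g h : inc h -> germ_le f g -> germ_le (h * f)%g (h * g)%g.
Proof.
move=> hi [M fg]; exists M => x /fg; rewrite !FM.
by rewrite le_eqVlt => /predU1P[->//|/(scaling_act_increasing hi)/ltW].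
Qed.

Lemma increasing_unbounded g M : inc g -> exists N, forall x, N <= x -> M <= F g x.
Proof.
move=> gi; have g0 := stretch_gt0 g.
pose B := C * `|M - F g 0| / lam g.
have B0 : 0 <= B by rewrite divr_ge0 ?mulr_ge0// ltW.
exists B => x Bx.
have gx0 : F g 0 <= F g x.
  have: 0 <= x by exact: le_trans Bx.
  by rewrite le_eqVlt => /predU1P[->//|/(scaling_act_increasing gi)/ltW].
have := Flb g x 0; rewrite subr0 [`|x|]ger0_norm; last exact: le_trans Bx.
rewrite [`|F g x - _|]ger0_norm ?subr_ge0// => h.
have : C * `|M - F g 0| <= C * (F g x - F g 0).
  by apply: le_trans h; rewrite [leRHS]mulrC -ler_pdivrMr.
by rewrite ler_pM2l//; have := ler_norm (M - F g 0); lra.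
Qed.

Lemma germ_leMr f g h : inc h -> germ_le f g -> germ_le (f * h)%g (g * h)%g.
Proof.
move=> hi [M fg]; have [N hN] := increasing_unbounded M hi.
by exists N => x /hN/fg; rewrite !FM.
Qed.

(** If [f] and [h] agree nowhere far out, the intermediate value theorem fixes
    the sign of their difference there.  Otherwise [h^-1 * f] has two fixed
    points, and [f] and [h] coincide. *)
Lemma germ_le_total f h : inc f -> inc h -> germ_le f h \/ germ_le h f.
Proof.
move=> fi hi.
have [[M fhN]|fh] := pselect (exists M, forall x, M <= x -> F f x != F h x).
  pose d x := F h x - F f x.
  have cd : continuous d.
    by move=> x; apply: cvgB; [exact: (scaling_continuous FA (g:=h) (x:=x))|
                               exact: (scaling_continuous FA (g:=f) (x:=x))].
  have dN x : M <= x -> d x != 0 by move=> /fhN; rewrite subr_eq0 eq_sym.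
  have sgn x : M <= x -> (0 < d x) = (0 < d M).
    move=> Mx; have := dN _ Mx; have := dN _ (lexx M).
    have no0 : ~ (Num.min (d M) (d x) <= 0 <= Num.max (d M) (d x)).
      move=> h0; have cd' := continuous_subspaceT cd.
      have [c + c0] := IVT Mx (cd' _) h0.
      by rewrite in_itv/= => /andP[/dN]; rewrite c0 eqxx.
    move: no0; rewrite le_max ge_min.
    by case: (ltgtP (d M) 0) => //; case: (ltgtP (d x) 0) => //= _ _ [].
  have [dM|dM] := boolP (0 < d M); [left|right]; exists M => x Mx.
    by rewrite -subr_ge0 ltW// [0 < _]sgn.
  by rewrite -subr_le0 leNgt [0 < _]sgn.
have meet M : exists2 x, M <= x & F f x = F h x.
  apply: contrapT => no; apply: fh; exists M => x Mx.
  by apply/eqP => fhx; apply: no; exists x.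
have [p _ fhp] := meet 0; have [r pr fhr] := meet (p + 1).
have id : forall x, F (h^-1 * f)%g x = x.
  apply: (@increasing_two_fixpoints _ p r); rewrite ?FM ?fhp ?fhr ?scaling_actK//.
  - by rewrite increasing_on_unitM increasing_on_unitV fi hi.
  - by apply: lt_le_trans pr; rewrite ltrDl.
left; exists 0 => x _; rewrite -{2}(id x) -FM mulgA mulgV mul1g.
exact: lexx.
Qed.

(** The stretch controls the increment over the interval from [M] to [M + n];
    for large [n] the offset [F h M - F f M] is negligible against it. *)
Lemma stretch_germ_le f h : inc f -> inc h -> germ_le f h ->
  lam f <= C * C * lam h.
Proof.
move=> fi hi [M fh]; rewrite -subr_le0.
apply: (@le0_of_bounded_multiples _ _ (C * (F h M - F f M))) => n.
have [->|n0] := eqVneq n 0%N; first by rewrite mul0r mulr_ge0 ?subr_ge0 ?fh// ltW.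
have n0' : 0 < n%:R :> R by rewrite ltr0n lt0n.
have Mn : M < M + n%:R by rewrite ltrDl.
have := Flb f (M + n%:R) M; have := Fub h (M + n%:R) M.
rewrite addrAC subrr add0r [`|n%:R|]gtr0_norm//.
rewrite !gtr0_norm ?subr_gt0; try exact: scaling_act_increasing.
rewrite -(ler_pM2l C0) => h1 h2.
have : C * F f (M + n%:R) <= C * F h (M + n%:R) by rewrite ler_pM2l// fh// ltW.
lra.
Qed.

(** The character is the exponential of the homogenized logarithm of [stretch],
    which is additive on the orientation preserving elements by the order of
    germs and on the others by the index-two argument. *)
Lemma stretch_character : exists c : G -> R,
  [/\ forall g, 0 < c g, forall g h, c (g * h)%g = c g * c h,
      forall g, c g <= C * lam g & forall g, lam g <= C * c g].
Proof.
pose a g := ln (lam g).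
have aD : forall g h, `|a (g * h)%g - a g - a h| <= ln C
  := ln_stretch_quasimorphism.
have [q qD] := quasimorphism_homogenization aD.
have qM : forall g h, q (g * h)%g = q g + q h.
  apply: (homogenization_additive_of_index2 aD qD (P := inc)).
    exact: increasing_on_unitM.
  apply: (homogenization_additive_of_preorder aD qD (P := inc)
    (le := germ_le) (E := ln (C * C))).
  - exact: increasing_on_unit1.
  - by move=> f h fi hi; rewrite increasing_on_unitM fi hi.
  - exact: germ_le_refl.
  - exact: germ_le_trans.
  - exact: germ_le_total.
  - by move=> f g h _ _; exact: germ_leMl.
  - by move=> f g h _ _; exact: germ_leMr.
  - move=> f h fi hi /(stretch_germ_le fi hi) fh; rewrite addrC /a.
    have [f0 h0] := (stretch_gt0 f, stretch_gt0 h).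
    by rewrite -lnM ?ler_ln ?posrE ?mulr_gt0.
exists (fun g => expR (q g)); split=> [g|g h|g|g].
- exact: expR_gt0.
- by rewrite qM expRD.
- have := qD g 1%N; rewrite expg1 mul1r ler_norml => /andP[_ h].
  rewrite -[C * _]lnK ?posrE ?mulr_gt0 ?stretch_gt0// ler_expR.
  rewrite lnM ?posrE ?stretch_gt0//.
  have := qD g 1%N; rewrite expg1 mul1r ler_norml /a => /andP[? ?]; lra.
- have := qD g 1%N; rewrite expg1 mul1r ler_norml /a => /andP[_ h].
  rewrite -[lam g]lnK ?posrE ?stretch_gt0// -[C]lnK ?posrE// -expRD ler_expR.
  lra.
Qed.

End Dynamics.

(** * The least length dominating the rescaled images *)

Lemma lipschitz_continuous (R : realType) (f : R -> R) (L : R) : 0 < L ->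
  (forall x y, `|f x - f y| <= L * `|x - y|) -> continuous f.
Proof.
move=> L0 fL x; apply/cvgrPdist_lt => e e0; near=> y.
apply: le_lt_trans (fL x y) _; rewrite mulrC -ltr_pdivlMr//.
near: y; apply: (@cvgr_dist_lt R R^o R (nbhs x) _ id x) => //.
by rewrite divr_gt0.
Unshelve. all: by end_near. Qed.

Lemma expanding_continuous_surjective (R : realType) (f : R -> R) :
  continuous f -> (forall x y : R, x <= y -> y - x <= f y - f x) ->
  forall t : R, exists x, f x = t.
Proof.
move=> cf fe t; pose m : R := `|t - f 0|.
have m0 : 0 <= m by exact: normr_ge0.
have := fe 0 m m0; have := fe (- m) 0; rewrite oppr_le0 => /(_ m0).
rewrite opprK add0r subr0 => h1 h2.
have mm : - m <= m by rewrite (le_trans _ m0)// oppr_le0.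
have tm : Num.min (f (- m)) (f m) <= t <= Num.max (f (- m)) (f m).
  have := ler_norm (t - f 0); have := ler_norm (f 0 - t).
  rewrite (distrC (f 0)) -/m ge_min le_max => ? ?.
  by apply/andP; split; apply/orP; [left|right]; lra.
have cf' := continuous_subspaceT cf.
by have [x _ <-] := IVT mm (cf' _) tm; exists x.
Qed.

Definition stretching_majorant (R : realType) (G : groupType) (F : G -> R -> R)
    (c : G -> R) (psi : R -> R) : Prop :=
  forall g x y, x <= y -> `|F g x - F g y| <= c g * (psi y - psi x).

(** The length of the interval from [x] to [y] for the supremum of the
    pseudometrics |g x - g y| / c g: the least additive function of intervals
    dominating them all.  As an infimum over majorants it needs no partitions, and its
    additivity comes from gluing two majorants. *)
Definition least_length (R : realType) (G : groupType) (F : G -> R -> R)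
    (c : G -> R) (x y : R) : R :=
  inf [set psi y - psi x | psi in stretching_majorant F c].

Definition least_length_coordinate (R : realType) (G : groupType)
    (F : G -> R -> R) (c : G -> R) (x : R) : R :=
  if 0 <= x then least_length F c 0 x else - least_length F c x 0.

Section InvariantLength.
Context {R : realType} {G : groupType} {F : G -> R -> R} {C : R}.
Hypothesis FA : uniformly_scaling_action F C.
Context {c : G -> R}.
Hypothesis c0 : forall g, 0 < c g.
Hypothesis cM : forall g h, c (g * h)%g = c g * c h.
Hypothesis stretch_le : forall g, stretch F g <= C * c g.

Local Notation majorant := (stretching_majorant F c).
Local Notation ell := (least_length F c).
Local Notation phi := (least_length_coordinate F c).

Let C0 : 0 < C. Proof. exact: lt_le_trans (scaling_ge1 FA). Qed.

Let c1 : c 1%g = 1.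
Proof.
apply: (mulfI (lt0r_neq0 (c0 1%g))).
by rewrite -cM mulg1 mulr1.
Qed.

Let cV g : c g^-1%g = (c g)^-1.
Proof.
apply: (mulfI (lt0r_neq0 (c0 g))).
by rewrite -cM mulgV c1 divff// lt0r_neq0.
Qed.

(** Here the character has to control the stretch factors: it provides one
    majorant, hence the finiteness of the length. *)
Lemma linear_majorant : majorant (fun x => C * C * x).
Proof.
move=> g x y xy; apply: le_trans (scaling_ub FA g x y) _.
rewrite distrC ger0_norm ?subr_ge0// -mulrBr mulrA.
rewrite ler_wpM2r ?subr_ge0// [leRHS]mulrC -mulrA ler_pM2l//.
Qed.

Lemma majorant_ge_sub psi x y : majorant psi -> x <= y -> y - x <= psi y - psi x.
Proof.
move=> psiM xy; have := psiM 1%g x y xy.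
by rewrite !(scaling_act1 FA) c1 mul1r distrC ger0_norm// subr_ge0.
Qed.

Lemma least_length_le psi x y : majorant psi -> x <= y -> ell x y <= psi y - psi x.
Proof.
move=> psiM xy; apply: ge_inf; last by exists psi.
by exists (y - x) => _ [psi' ? <-]; exact: majorant_ge_sub.
Qed.

Lemma le_least_length m x y :
  (forall psi, majorant psi -> m <= psi y - psi x) -> m <= ell x y.
Proof.
move=> h; apply: lb_le_inf; last by move=> _ [psi /h ? <-].
by eexists; eexists; first exact: linear_majorant.
Qed.

Lemma least_length_ge_sub x y : x <= y -> y - x <= ell x y.
Proof. by move=> xy; apply: le_least_length => psi /majorant_ge_sub; exact. Qed.

Lemma least_length_le_sub x y : x <= y -> ell x y <= C * C * (y - x).
Proof. by move=> xy; rewrite mulrBr (least_length_le linear_majorant xy). Qed.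

(** The triangle inequality at [y] is what lets two unrelated majorants be
    joined there. *)
Lemma glued_majorant psi1 psi2 y : majorant psi1 -> majorant psi2 ->
  majorant (fun x => if x <= y then psi1 x - psi1 y else psi2 x - psi2 y).
Proof.
move=> M1 M2 g u v uv; have [uy|yu] := leP u y; have [vy|yv] := leP v y.
- by have := M1 g u v uv; rewrite opprB addrA subrK.
- apply: le_trans (ler_distD (F g y) _ _) _.
  have := M1 g u y uy; have := M2 g y v (ltW yv).
  by lra.
- by have := le_lt_trans (le_trans uv vy) yu; rewrite ltxx.
- by have := M2 g u v uv; rewrite opprB addrA subrK.
Qed.

Lemma least_length_add x y z : x <= y -> y <= z -> ell x z = ell x y + ell y z.
Proof.
move=> xy yz; apply/eqP; rewrite eq_le; apply/andP; split; last first.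
  apply: le_least_length => psi psiM.
  have := least_length_le psiM xy; have := least_length_le psiM yz; lra.
rewrite -lerBlDr; apply: le_least_length => psi1 M1.
rewrite lerBlDr -lerBlDl; apply: le_least_length => psi2 M2.
have := least_length_le (glued_majorant y M1 M2) (le_trans xy yz).
rewrite xy; case: ifPn => [zy|_]; last by lra.
have -> : z = y by apply/eqP; rewrite eq_le zy yz.
lra.
Qed.

(** Composing with [g] turns the condition for [h * g^-1] into the condition for
    [h], and multiplicativity of [c] accounts for the factor. *)
Lemma act_increasing_majorant g psi : increasing_on_unit F g -> majorant psi ->
  majorant (fun x => psi (F g x) / c g).
Proof.
move=> gi psiM h x y xy.
have gxy : F g x <= F g y by rewrite (ltW_homo (scaling_act_increasing FA gi)).
have := psiM (h * g^-1)%g _ _ gxy.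
rewrite !(scaling_actM FA) !(scaling_actK FA) cM cV -mulrBl.
by rewrite -!mulrA [_^-1 * _]mulrC.
Qed.

Lemma act_decreasing_majorant g psi : ~~ increasing_on_unit F g -> majorant psi ->
  majorant (fun x => - psi (F g x) / c g).
Proof.
move=> gi psiM h x y xy.
have gxy : F g y <= F g x by rewrite (ltW_nhomo (scaling_act_decreasing FA gi)).
have := psiM (h * g^-1)%g _ _ gxy.
rewrite !(scaling_actM FA) !(scaling_actK FA) cM cV -mulrBl distrC.
by rewrite opprK [- _ + _]addrC -!mulrA [_^-1 * _]mulrC.
Qed.

(** Pulling majorants back by [g] gives one inequality, and the same inequality
    for [g^-1] is the other one. *)
Lemma least_length_act_increasing g x y : increasing_on_unit F g -> x <= y ->
  ell (F g x) (F g y) = c g * ell x y.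
Proof.
have le g' x' y' : increasing_on_unit F g' -> x' <= y' ->
    c g' * ell x' y' <= ell (F g' x') (F g' y').
  move=> gi xy; apply: le_least_length => psi psiM.
  have := least_length_le (act_increasing_majorant gi psiM) xy.
  by rewrite -mulrBl ler_pdivlMr// mulrC.
move=> gi xy; apply/eqP; rewrite eq_le le// andbT.
have gxy : F g x <= F g y by rewrite (ltW_homo (scaling_act_increasing FA gi)).
have := le g^-1%g _ _ _ gxy; rewrite (increasing_on_unitV FA) => /(_ gi).
by rewrite !(scaling_actK FA) cV ler_pdivrMl.
Qed.

Lemma least_length_act_decreasing g x y : ~~ increasing_on_unit F g -> x <= y ->
  ell (F g y) (F g x) = c g * ell x y.
Proof.
have le g' x' y' : ~~ increasing_on_unit F g' -> x' <= y' ->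
    c g' * ell x' y' <= ell (F g' y') (F g' x').
  move=> gi xy; apply: le_least_length => psi psiM.
  have := least_length_le (act_decreasing_majorant gi psiM) xy.
  by rewrite -mulrBl ler_pdivlMr// mulrC opprK [- _ + _]addrC.
move=> gi xy; apply/eqP; rewrite eq_le le// andbT.
have gxy : F g y <= F g x by rewrite (ltW_nhomo (scaling_act_decreasing FA gi)).
have := le g^-1%g _ _ _ gxy; rewrite (increasing_on_unitV FA) => /(_ gi).
by rewrite !(scaling_actK FA) cV ler_pdivrMl.
Qed.

Lemma least_length_coordinateB x y : x <= y -> phi y - phi x = ell x y.
Proof.
move=> xy; rewrite /least_length_coordinate.
have [y0|y0] := leP 0 y; have [x0|x0] := leP 0 x.
- by rewrite (least_length_add x0 xy) addrAC subrr add0r.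
- by rewrite opprK addrC -(least_length_add (ltW x0) y0).
- by have := le_lt_trans (le_trans x0 xy) y0; rewrite ltxx.
- by have := least_length_add xy (ltW y0); lra.
Qed.

Lemma least_length_coordinate_bilipschitz x y :
  `|x - y| <= `|phi x - phi y| <= C * C * `|x - y|.
Proof.
wlog xy : x y / x <= y.
  have [xy|/ltW yx] := leP x y; first exact.
  by rewrite distrC (distrC (phi x)); exact.
rewrite (distrC x) (distrC (phi x)) least_length_coordinateB//.
have h := least_length_ge_sub xy.
rewrite !ger0_norm ?subr_ge0//; last by rewrite (le_trans _ h)// subr_ge0.
by rewrite h least_length_le_sub.
Qed.

Lemma least_length_coordinate_act g : exists2 r : R, r != 0 &
  forall x y, phi (F g x) - phi (F g y) = r * (phi x - phi y).
Proof.
suff [r r0 rP] : exists2 r : R, r != 0 & forall x y, x <= y ->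
    phi (F g y) - phi (F g x) = r * (phi y - phi x).
  exists r => // x y; have [xy|/ltW yx] := leP x y; last exact: rP.
  by rewrite -opprB rP// -mulrN opprB.
have [gi|gi] := boolP (increasing_on_unit F g).
  exists (c g) => [|x y xy]; first by rewrite lt0r_neq0.
  have gxy : F g x <= F g y by rewrite (ltW_homo (scaling_act_increasing FA gi)).
  by rewrite !least_length_coordinateB// least_length_act_increasing.
exists (- c g) => [|x y xy]; first by rewrite oppr_eq0 lt0r_neq0.
have gxy : F g y <= F g x by rewrite (ltW_nhomo (scaling_act_decreasing FA gi)).
rewrite -opprB !least_length_coordinateB// least_length_act_decreasing//.
by rewrite mulNr.
Qed.

Lemma least_length_coordinate_surjective t : exists x, phi x = t.
Proof.
apply: expanding_continuous_surjective => [|x y xy].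
  apply: (@lipschitz_continuous _ _ (C * C)); first exact: mulr_gt0.
  by move=> x y; have /andP[] := least_length_coordinate_bilipschitz x y.
by rewrite least_length_coordinateB// least_length_ge_sub.
Qed.

End InvariantLength.

Lemma affine_coordinate (R : realType) (G : groupType) (F : G -> R -> R) (C : R) :
  uniformly_scaling_action F C ->
  exists phi phi' : R -> R, [/\ cancel phi phi', cancel phi' phi,
    forall x y, `|x - y| <= `|phi x - phi y| <= C * C * `|x - y| &
    forall g, exists2 r : R, r != 0 &
      forall x y, phi (F g x) - phi (F g y) = r * (phi x - phi y)].
Proof.
move=> FA; have [c [c0 cM _ cge]] := stretch_character FA.
pose phi := least_length_coordinate F c.
have bil : forall x y, `|x - y| <= `|phi x - phi y| <= C * C * `|x - y|.
  by move=> x y; exact: (least_length_coordinate_bilipschitz FA c0 cM cge x y).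
have [phi' phi'K] : {phi' & cancel phi' phi}
  := choice (least_length_coordinate_surjective FA c0 cM cge).
exists phi, phi'; split => // [x|g].
  apply/eqP; rewrite -subr_eq0 -normr_le0.
  by have /andP[+ _] := bil (phi' (phi x)) x; rewrite phi'K subrr normr0.
exact: (least_length_coordinate_act FA c0 cM cge g).
Qed.

(** * From quasisimilarities to uniformly scaling actions *)

Section QuasisimilaritySlopes.
Context {R : realType} {K : R} {f : R^o -> R^o}.
Hypothesis K1 : 1 <= K.
Hypothesis fI : injective f.
Hypothesis fK : is_quasisimilarity K f.

Local Notation slope x y := (`|f x - f y| / `|x - y| : R).

Let slope_sym (x y : R) : slope x y = slope y x.
Proof. by rewrite distrC (distrC x). Qed.

Let slope_gt0 (x y : R) : x != y -> 0 < slope x y.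
Proof. by move=> xy; rewrite divr_gt0// normr_gt0 subr_eq0// (inj_eq fI). Qed.

Lemma quasisimilarity_slope_common (x y z : R) : x != y -> x != z ->
  slope x z <= K * slope x y.
Proof.
move=> xy xz; have [<-|yz] := eqVneq y z.
  by rewrite ler_peMl// ltW// slope_gt0.
have mE (u v : R^o) : mdist u v = `|v - u| :> R by [].
have /andP[_] := fK (elimN eqP xy) (elimN eqP yz) (elimN eqP xz).
by rewrite !mE ler_pdivrMr// slope_gt0.
Qed.

(** The definition compares two pairs sharing a point; two arbitrary pairs are
    compared through the pair formed by one point of each, at the cost of a
    second factor [K]. *)
Lemma quasisimilarity_slope_le (x y u v : R) : x != y -> u != v ->
  slope u v <= K * K * slope x y.
Proof.
move=> xy uv; have [ux|ux] := eqVneq u x.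
  rewrite ux in uv *; apply: le_trans (quasisimilarity_slope_common xy uv) _.
  by rewrite -mulrA ler_peMl// mulr_ge0 ?(le_trans ler01 K1)// ltW// slope_gt0.
apply: le_trans (quasisimilarity_slope_common ux uv) _.
rewrite -mulrA ler_pM2l ?(lt_le_trans ltr01 K1)// slope_sym.
by rewrite quasisimilarity_slope_common// eq_sym.
Qed.

Lemma quasisimilarity_dist_le (x y u v : R) : x != y ->
  `|f u - f v| * `|x - y| <= K * K * `|f x - f y| * `|u - v|.
Proof.
move=> xy; have [->|uv] := eqVneq u v; first by rewrite !subrr normr0 mulr0 mul0r.
have := quasisimilarity_slope_le xy uv.
have [xy0 uv0] : 0 < `|x - y| /\ 0 < `|u - v| by rewrite !normr_gt0 !subr_eq0.
by rewrite ler_pdivrMr// mulrA mulrAC ler_pdivlMr.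
Qed.

End QuasisimilaritySlopes.

Lemma quasisimilarity_action_scaling (R : realType) (G : groupType) (K : R)
    (rho : UMagmaMorphism.type G (bilip R^o)) :
  1 <= K -> quasisimilarity_action K rho ->
  uniformly_scaling_action (fun g => rho g : R -> R) (K * K).
Proof.
move=> K1 rhoK.
have rI g : injective (rho g).
  by case: (bilip_homeo (rho g)) => rhoK' _ _ _; exact: can_inj rhoK'.
have n01 : (1 : R) != 0 by exact: oner_neq0.
split=> [x|g h x|g||g x y|g x y].
- by rewrite gmulf1.
- by rewrite gmulfM.
- by case: (bilip_homeo (rho g)).
- by rewrite -[1]mulr1 ler_pM.
- have := quasisimilarity_dist_le K1 (rI g) (rhoK g) x y n01.
  by rewrite subr0 normr1 mulr1.
- have [->|xy] := eqVneq x y; first by rewrite !subrr normr0 !mulr0.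
  have := quasisimilarity_dist_le K1 (rI g) (rhoK g) 1 0 xy.
  by rewrite subr0 normr1 mulr1.
Qed.

Lemma bilip_of_expanding (R : realType) (phi phi' : R -> R) (L : R) : 1 <= L ->
  cancel phi phi' -> cancel phi' phi ->
  (forall x y, `|x - y| <= `|phi x - phi y| <= L * `|x - y|) ->
  exists2 f : bilip R^o, is_bilipschitz L f &
    bilip_fun f = phi /\ bilip_inv f = phi'.
Proof.
move=> L1 phiK phi'K bil; have L0 : 0 < L by exact: lt_le_trans L1.
have homeo : is_homeomorphism (phi : R^o -> R^o) (phi' : R^o -> R^o).
  split=> //.
    by apply: (lipschitz_continuous L0) => x y; have /andP[] := bil x y.
  apply: (lipschitz_continuous ltr01) => x y.
  by have /andP[+ _] := bil (phi' x) (phi' y); rewrite !phi'K mul1r.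
have bound : is_bilipschitz L (phi : R^o -> R^o).
  have mE (u v : R^o) : mdist u v = `|v - u| :> R by [].
  move=> x y; have /andP[h ->] := bil y x; rewrite !mE andbT.
  by apply: le_trans h; rewrite ler_piMl// invf_le1.
by exists (MkBilip homeo (ex_intro2 _ _ L L1 bound)).
Qed.

Theorem theorem3p2 (R : realType) :
  (forall (G : groupType) (rho : UMagmaMorphism.type G (bilip R^o)),
     uniform_quasisimilarity_action rho ->
     exists phi : bilip R^o,
       forall g : G, Aff R (phi * rho g * phi^-1)%g) /\
  (forall K : R, 1 <= K ->
     exists2 L : R, 1 <= L &
       forall (G : groupType) (rho : UMagmaMorphism.type G (bilip R^o)),
         quasisimilarity_action K rho ->
         exists2 phi : bilip R^o,
           is_bilipschitz L phi &
           forall g : G, Aff R (phi * rho g * phi^-1)%g).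
Proof.
suff main : forall K : R, 1 <= K ->
    exists2 L : R, 1 <= L &
      forall (G : groupType) (rho : UMagmaMorphism.type G (bilip R^o)),
        quasisimilarity_action K rho ->
        exists2 phi : bilip R^o, is_bilipschitz L phi &
          forall g : G, Aff R (phi * rho g * phi^-1)%g.
  split=> // G rho [K /main[L _ LP] /LP[phi _ phiA]].
  by exists phi.
move=> K K1; pose C := K * K.
have C1 : 1 <= C by rewrite -[1]mulr1 ler_pM.
have CC1 : 1 <= C * C by rewrite -[1]mulr1 ler_pM.
exists (C * C) => // G rho /(quasisimilarity_action_scaling K1)/affine_coordinate.
move=> [phi [phi' [phiK phi'K bil equiv]]].
have [f fL [fE f'E]] := bilip_of_expanding CC1 phiK phi'K bil.
exists f => // g; have [r r0 rP] := equiv g.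
pose t := phi (rho g (phi' 0)).
exists r, t; split=> // x.
have -> : bilip_fun (f * rho g * f^-1)%g x = phi (rho g (phi' x)).
  by rewrite -fE -f'E.
by apply/eqP; rewrite -subr_eq rP !phi'K subr0.
Qed.
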